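(* Let $C\geq 1$ and let $S$ be a semilattice such that $\mathcal{A}_S$ is $C$-biflat. Then $S$ is locally $C$-finite, i.e. $|\{y\in S: y\preceq f\}|\leq C$ for every $f\in S$. Also, if we regard the Schützenberger representation of $S$ as an algebra homomorphism $\mathsf{Sch}:\mathcal{A}_S\to\mathsf{P}(S)$ (which is well defined and invertible), then $\|\mathsf{Sch}^{-1}\|\leq C$.
   Context: A semilattice is a commutative semigroup in which every element is idempotent; its canonical partial order is $e\preceq f \iff ef=e$. For a semilattice $S$, $\mathcal{A}_S$ denotes its $\ell^1$-convolution algebra: the Banach space $\ell^1(S)$ with canonical basis $(e_s)_{s\in S}$ and the bounded bilinear product determined by $e_se_t=e_{st}$. The Schützenberger representation of $S$ is the bounded linear map $\mathsf{Sch}:\mathcal{A}_S\to\ell^\infty(S)$ determined by $\mathsf{Sch}(e_t)=\mathbf{1}_{\{y\in S: y\preceq t\}}$ (indicator function) for $t\in S$; it is an algebra homomorphism for pointwise multiplication on $\ell^\infty(S)$. $\mathsf{P}(S)$ denotes the Banach space $\ell^1(S)$ equipped with pointwise multiplication, viewed inside $\ell^\infty(S)$. For a Banach algebra $A$, let $\pi:A\widehat{\otimes}A\to A$ be the bounded linear map with $\pi(a\otimes b)=ab$ ($\widehat\otimes$ is the projective tensor product), let $''$ denote second dual / second adjoint, and let $\kappa:A\to A''$ be the natural embedding. $A\widehat{\otimes}A$ is an $A$-bimodule via $a\cdot(b\otimes c)=ab\otimes c$, $(b\otimes c)\cdot a=b\otimes ca$, and $(A\widehat{\otimes}A)''$ is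 an $A$-bimodule canonically. $A$ is $C$-biflat if there is a bounded $A$-bimodule map $\sigma:A\to(A\widehat{\otimes}A)''$ with $\pi''\sigma=\kappa$ and $\|\sigma\|\leq C$. *)

(* Defs.v *)
From HB Require Import structures.
From mathcomp Require Import all_boot all_order all_algebra finmap sesquilinear.
From mathcomp Require Import all_classical all_reals all_analysis.
From mathcomp Require Import complex.
From mathcomp Require summability.
Import numFieldNormedType.Exports.
Set Implicit Arguments.
Unset Strict Implicit.
Unset Printing Implicit Defensive.
Import Order.TTheory GRing.Theory Num.Theory.
Local Open Scope classical_set_scope.
Local Open Scope ring_scope.
Local Open Scope complex_scope.

(* R[i] itself, not R[i]^o, serves as the scalar Banach space: completeness of
   K^o is already registered for K : realType, which blocks a second instance
   for R[i]^o *)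
HB.instance Definition _ (R : realType) := NormedModule.copy R[i] R[i]^o.

Section rnorm.
Context {R : realType}.
Implicit Types V : normedModType R[i].

(* the norm of a complex normed module is R[i]-valued; rnorm is its value in R *)
Definition rnorm V (x : V) : R := complex.Re `|x|.

Lemma rnormE V (x : V) : `|x| = (rnorm x)%:C.
Proof. by rewrite /rnorm RRe_real// ger0_real. Qed.

Lemma rnorm_ge0 V (x : V) : 0 <= rnorm x.
Proof. by rewrite -lecR -rnormE normr_ge0. Qed.

Lemma rnorm0 V : rnorm (0 : V) = 0.
Proof. by rewrite /rnorm normr0. Qed.

Lemma rnormD V (x y : V) : rnorm (x + y) <= rnorm x + rnorm y.
Proof. by rewrite -lecR rmorphD/= -!rnormE ler_normD. Qed.

Lemma rnormN V (x : V) : rnorm (- x) = rnorm x.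
Proof. by rewrite /rnorm normrN. Qed.

Lemma rnormZ V (k : R[i]) (x : V) :
  rnorm (k *: x) = rnorm k * rnorm x.
Proof. by apply: complexI; rewrite rmorphM/= -!rnormE normrZ. Qed.

Lemma rnorm_eq0 V (x : V) : rnorm x = 0 -> x = 0.
Proof. by move=> x0; apply/normr0_eq0; rewrite rnormE x0. Qed.

Lemma rnorm_sum V (I : Type) (r : seq I) (P : pred I) (F : I -> V) :
  rnorm (\sum_(i <- r | P i) F i) <= \sum_(i <- r | P i) rnorm (F i).
Proof.
elim/big_ind2 : _ => [|x y z t xy zt|//]; first by rewrite rnorm0.
by rewrite (le_trans (rnormD _ _))// lerD.
Qed.

End rnorm.

Section blin.
Context {R : realType}.
Variables U V : normedModType R[i].

Definition bounded_linear : {pred U -> V} := fun f =>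
  `[< linear f /\ exists M : R, forall x, rnorm (f x) <= M * rnorm x >].

Record blin := Blin { blin_fun :> U -> V ; _ : blin_fun \in bounded_linear }.

HB.instance Definition _ := [isSub for blin_fun].
HB.instance Definition _ := gen_eqMixin blin.
HB.instance Definition _ := gen_choiceMixin blin.

Lemma bounded_linearP (f : U -> V) :
  reflect (linear f /\ exists M : R, forall x, rnorm (f x) <= M * rnorm x)
    (f \in bounded_linear).
Proof. exact: asboolP. Qed.

Lemma bounded_linear_submod : GRing.submod_closed bounded_linear.
Proof.
split=> [|k f g /bounded_linearP[lf [M hM]] /bounded_linearP[lg [N hN]]];
    apply/bounded_linearP; split.
- by move=> a x y /=; rewrite scaler0 add0r.
- by exists 0 => x /=; rewrite mul0r rnorm0.
- move=> a x y; rewrite /= !fctE lf lg/=.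
  by rewrite !scalerDr !scalerA addrACA (mulrC k).
- exists (rnorm k * M + N) => x; rewrite !fctE.
  rewrite (le_trans (rnormD _ _))// mulrDl lerD// rnormZ -mulrA.
  by rewrite ler_wpM2l// rnorm_ge0.
Qed.

HB.instance Definition _ :=
  GRing.isSubmodClosed.Build _ _ bounded_linear bounded_linear_submod.
HB.instance Definition _ := [SubChoice_isSubLmodule of blin by <:].
End blin.
Arguments bounded_linear {R U V}.

Section blin_norm.
Context {R : realType}.
Variables U V : normedModType R[i].
Implicit Types f g : blin U V.

Lemma blin_linear f : linear f.
Proof. by have /bounded_linearP[] := valP f. Qed.

HB.instance Definition _ f := GRing.isLinear.Build _ _ _ _ f (blin_linear f).

Lemma blinP f g : f =1 g -> f = g.
Proof. by move=> /funext fg; apply: val_inj. Qed.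

Lemma blinE :
  (forall x, (0 : blin U V) x = 0) * (forall f g x, (f + g) x = f x + g x) *
  (forall k f x, (k *: f) x = k *: f x).
Proof. by []. Qed.

Definition opnorm f : R :=
  inf [set M | 0 <= M /\ forall x, rnorm (f x) <= M * rnorm x].

Let S f := [set M | 0 <= M /\ forall x, rnorm (f x) <= M * rnorm x].

Let hasS f : has_inf (S f).
Proof.
split; last by exists 0 => M [].
have /bounded_linearP[_ [M hM]] := valP f.
exists `|M| => /=; split => // x; rewrite (le_trans (hM x))//.
by rewrite ler_wpM2r ?rnorm_ge0// ler_norm.
Qed.

Lemma opnorm_ge0 f : 0 <= opnorm f.
Proof. by apply: lb_le_inf; [case: (hasS f)|move=> M []]. Qed.

Lemma opnorm_le f M :
  0 <= M -> (forall x, rnorm (f x) <= M * rnorm x) -> opnorm f <= M.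
Proof. by move=> M0 hM; apply: ge_inf; [case: (hasS f)|split]. Qed.

Lemma opnormP f x : rnorm (f x) <= opnorm f * rnorm x.
Proof.
have [x0|x0] := eqVneq (rnorm x) 0.
  by have /bounded_linearP[_ [M /(_ x)]] := valP f; rewrite x0 !mulr0.
rewrite -ler_pdivrMr ?lt_def ?x0 ?rnorm_ge0//.
apply: lb_le_inf; first by case: (hasS f).
by move=> M [_ /(_ x)]; rewrite ler_pdivrMr// lt_def x0 rnorm_ge0.
Qed.

Let cnorm f : R[i] := (opnorm f)%:C.

Let cnormD f g : cnorm (f + g) <= cnorm f + cnorm g.
Proof.
rewrite -rmorphD lecR; apply: opnorm_le => [|x].
  by rewrite addr_ge0// opnorm_ge0.
by rewrite blinE (le_trans (rnormD _ _))// mulrDl lerD// opnormP.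
Qed.

Let opnormZ_le (k : R[i]) f : opnorm (k *: f) <= rnorm k * opnorm f.
Proof.
apply: opnorm_le => [|x]; first by rewrite mulr_ge0 ?rnorm_ge0 ?opnorm_ge0.
by rewrite blinE rnormZ -mulrA ler_wpM2l ?rnorm_ge0 ?opnormP.
Qed.

Let cnormZ (k : R[i]) f : cnorm (k *: f) = `|k| * cnorm f.
Proof.
rewrite (rnormE k) -rmorphM; congr (_%:C); apply: le_anti.
rewrite opnormZ_le/=; have [->|k0] := eqVneq k 0.
  by rewrite rnorm0 mul0r opnorm_ge0.
rewrite -[f in leLHS](scalerK k0); set g := k *: f.
have := ler_wpM2l (rnorm_ge0 k) (opnormZ_le k^-1 g).
move=> /le_trans; apply; rewrite mulrA -rnormZ.
suff -> : rnorm (k *: (k^-1 : R[i])) = 1 by rewrite mul1r.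
by rewrite /rnorm (_ : k *: _ = 1) ?normr1//; exact: mulfV.
Qed.

Let cnorm0_eq0 f : cnorm f = 0 -> f = 0.
Proof.
move=> /complexI f0; apply: blinP => x; rewrite blinE; apply: rnorm_eq0.
by apply: le_anti; rewrite rnorm_ge0 andbT (le_trans (opnormP f x))// f0 mul0r.
Qed.

HB.instance Definition _ := isPointed.Build (blin U V) 0.
HB.instance Definition _ :=
  Lmodule_isNormed.Build R[i] (blin U V) cnormD cnormZ cnorm0_eq0.

Lemma blin_normE f : rnorm f = opnorm f.
Proof. by []. Qed.

Lemma blin_le f x : rnorm (f x) <= rnorm f * rnorm x.
Proof. exact: opnormP. Qed.

End blin_norm.

Notation dual U := (blin U (_[i])).

Section duality.
Context {R : realType}.
Implicit Types U V W : normedModType R[i].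

Lemma blin_comp_subproof U V W (g : blin V W) (f : blin U V) :
  (fun x => g (f x)) \in bounded_linear.
Proof.
apply/bounded_linearP; split=> [k x y|]; first by rewrite /= !linearP.
exists (rnorm g * rnorm f) => x/=; rewrite (le_trans (opnormP g _))// -mulrA.
by apply: ler_wpM2l; [exact: opnorm_ge0|exact: blin_le].
Qed.

Definition blin_comp U V W (g : blin V W) (f : blin U V) : blin U W :=
  Blin (blin_comp_subproof g f).

Lemma opnorm_comp U V W (g : blin V W) (f : blin U V) :
  rnorm (blin_comp g f) <= rnorm g * rnorm f.
Proof.
apply: opnorm_le => [|x]; first by rewrite mulr_ge0 ?rnorm_ge0.
rewrite (le_trans (blin_le g _))// -mulrA.
by apply: ler_wpM2l; [exact: rnorm_ge0|exact: blin_le].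
Qed.

Lemma adjoint_subproof U V (f : blin U V) :
  (fun phi : dual V => blin_comp phi f : dual U) \in bounded_linear.
Proof.
apply/bounded_linearP; split=> [k phi psi|]; first exact/blinP.
exists (rnorm f) => phi; rewrite mulrC; exact: opnorm_comp.
Qed.

Definition adjoint U V (f : blin U V) : blin (dual V) (dual U) :=
  Blin (adjoint_subproof f).

Lemma eval_subproof U (x : U) : (fun phi : dual U => phi x) \in bounded_linear.
Proof.
apply/bounded_linearP; split=> [k phi psi|]; first by [].
by exists (rnorm x) => phi; rewrite mulrC; exact: blin_le.
Qed.

Lemma bidual_emb_subproof U :
  (fun x : U => Blin (eval_subproof x) : dual (dual U)) \in bounded_linear.
Proof.
apply/bounded_linearP; split=> [k x y|].
  by apply: blinP => phi; rewrite !blinE /= linearP.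
exists 1 => x; rewrite mul1r.
by apply: opnorm_le => [|phi]; [exact: rnorm_ge0|rewrite mulrC; exact: (blin_le phi x)].
Qed.

Definition bidual_emb U : blin U (dual (dual U)) := Blin (bidual_emb_subproof U).

End duality.

(* associative, not necessarily unital *)
HB.mixin Record isBanachAlgebra (K : numFieldType) A
    & CompleteNormedModule K A := {
  bmul : A -> A -> A ;
  bmulA : associative bmul ;
  bmulDl : forall a b c, bmul (a + b) c = bmul a c + bmul b c ;
  bmulDr : forall a b c, bmul a (b + c) = bmul a b + bmul a c ;
  bscaleAl : forall (k : K) a b, k *: bmul a b = bmul (k *: a) b ;
  bscaleAr : forall (k : K) a b, k *: bmul a b = bmul a (k *: b) ;
  bmul_norm : forall a b, `|bmul a b| <= `|a| * `|b|
}.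

#[short(type="banachAlgType")]
HB.structure Definition BanachAlgebra (K : numFieldType) :=
  {A of CompleteNormedModule K A & isBanachAlgebra K A}.

Arguments bmul {K A} : rename.
Notation "a '**' b" := (bmul a b) (at level 40, left associativity) : ring_scope.

Section rnorm_topology.
Context {R : realType}.
Implicit Types V : normedModType R[i].

Lemma gt0_complexP (e : R[i]) : 0 < e -> exists2 r : R, 0 < r & e = r%:C.
Proof.
move=> e0; have eR : (complex.Re e)%:C = e by rewrite RRe_real// gtr0_real.
by exists (complex.Re e); rewrite ?eR// -ltcR eR.
Qed.

Lemma ltr_rnorm V (x : V) (r : R) : (`|x| < r%:C) = (rnorm x < r).
Proof. by rewrite rnormE ltcR. Qed.

Lemma ler_rnorm V (x : V) (r : R) : (`|x| <= r%:C) = (rnorm x <= r).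
Proof. by rewrite rnormE lecR. Qed.

Lemma cvg_rnorm_leP V T (F : set_system T) (FF : Filter F) (f : T -> V) (l : V) :
  f x @[x --> F] --> l <->
  forall e : R, 0 < e -> \forall x \near F, rnorm (l - f x) <= e.
Proof.
split=> [/cvgrPdist_le H e e0|H].
  have := H e%:C; rewrite ltcR => /(_ e0); apply: filterS => x.
  by rewrite ler_rnorm.
apply/cvgrPdist_le => _ /gt0_complexP[e e0 ->].
by apply: filterS (H _ e0) => x; rewrite ler_rnorm.
Qed.

Lemma cauchy_rnormP V (F : set_system V) (FF : ProperFilter F) :
  cauchy F <-> forall e : R, 0 < e -> exists x, F [set y | rnorm (x - y) < e].
Proof.
split=> [/cauchyP H e e0|H].
  have [|x Fx] := H e%:C; first by rewrite ltcR.
  by exists x; apply: filterS Fx => y; rewrite -ball_normE/= ltr_rnorm.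
apply/cauchyP => _ /gt0_complexP[e e0 ->]; have [x Fx] := H _ e0.
by exists x; apply: filterS Fx => y; rewrite -ball_normE/= ltr_rnorm.
Qed.

Lemma rnormMr (x y : R[i]) :
  rnorm (x * y) = rnorm x * rnorm y.
Proof. exact: (rnormZ x (y : R[i])). Qed.

Lemma rnorm_real (r : R) : rnorm (r%:C : R[i]) = `|r|.
Proof. by rewrite /rnorm normc_def/= expr0n/= addr0 sqrtr_sqr. Qed.

Lemma rnorm1 : rnorm (1 : R[i]) = 1.
Proof. by rewrite /rnorm normr1. Qed.

Lemma rnormi : rnorm ('i : R[i]) = 1.
Proof. by rewrite /rnorm normc_def/= expr0n/= expr1n add0r sqrtr1. Qed.

Lemma rnorm_ge_Re (z : R[i]) : `|complex.Re z| <= rnorm z.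
Proof. by have := normc_ge_Re z; rewrite (rnormE (z : R[i])) lecR. Qed.

Lemma rnorm_ge_Im (z : R[i]) : `|complex.Im z| <= rnorm z.
Proof.
have := rnorm_ge_Re (z * 'i); rewrite rnormMr rnormi mulr1.
by case: z => a b /=; rewrite mulr0 mulr1 sub0r normrN.
Qed.

Lemma complex_complete (F : set_system R[i]) :
  ProperFilter F -> cauchy F -> cvg F.
Proof.
move=> FF /cauchy_rnormP H.
have part (p : R[i] -> R) : (forall z, `|p z| <= rnorm z) ->
    {morph p : x y / x - y} -> cvg (p x @[x --> F]).
  move=> pn pB; apply: R_complete; apply/cauchyP => e /H[x Fx].
  exists (p x); apply: (filterS _ Fx : F (p @^-1` ball (p x) e)) => y xy.
  by change (`|p x - p y| < e); rewrite -pB; exact: le_lt_trans (pn _) xy.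
have /cvg_ex[a /cvgrPdist_le Ha] := part (@complex.Re R) rnorm_ge_Re (raddfB _).
have /cvg_ex[b /cvgrPdist_le Hb] := part (@complex.Im R) rnorm_ge_Im (raddfB _).
apply/cvg_ex; exists ((a +i* b)%C : R[i]); apply/cvg_rnorm_leP => e e0.
have e20 : 0 < e / 2 by rewrite divr_gt0.
near=> z.
have -> : ((a +i* b)%C : R[i]) - z =
    (a - complex.Re z)%:C + 'i * (b - complex.Im z)%:C.
  by case: (z) => u v; apply/eqP; rewrite eq_complex/=
    !(mul0r, mulr0, mul1r, subr0, addr0, add0r) !eqxx.
rewrite (le_trans (rnormD _ _))// rnormMr rnormi mul1r !rnorm_real (splitr e).
by apply: lerD; near: z; [exact: Ha|exact: Hb].
Unshelve. all: by end_near. Qed.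

End rnorm_topology.

HB.instance Definition _ (R : realType) :=
  Uniform_isComplete.Build R[i] (@complex_complete R).

Section finite_sums.
Context {R : realType} {I : choiceType}.
Implicit Types (F : I -> R) (A : {fset I}).

Lemma fsum_le_esum F A : (forall i, 0 <= F i) ->
  ((\sum_(i <- A) F i)%:E <= \esum_(i in [set: I]) (F i)%:E)%E.
Proof.
move=> F0; apply: esum_ge; exists [set` A]; first by split.
by rewrite fsbig_finite//= set_fsetK sumEFin.
Qed.

Lemma esum_le_fsum F (M : R) : (forall A, \sum_(i <- A) F i <= M) ->
  (\esum_(i in [set: I]) (F i)%:E <= M%:E)%E.
Proof.
move=> FM; apply: ge_ereal_sup => _ [X [finX _]] <-.
by rewrite fsbig_finite//= sumEFin lee_fin.
Qed.

Lemma esum_fin F (M : R) : (forall i, 0 <= F i) ->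
    (forall A, \sum_(i <- A) F i <= M) ->
  (\esum_(i in [set: I]) (F i)%:E \is a fin_num)%E.
Proof.
move=> F0 FM; rewrite ge0_fin_numE; last first.
  by apply: esum_ge0 => i _; rewrite lee_fin.
exact: le_lt_trans (esum_le_fsum FM) (ltry _).
Qed.

End finite_sums.

Section ell1.
Context {R : realType} {S : choiceType}.

Definition l1_summable : {pred S -> R[i]} := fun f =>
  `[< summable [set: S] (fun s => (rnorm (f s))%:E) >].

Definition l1norm (f : S -> R[i]) : R :=
  fine (\esum_(s in [set: S]) (rnorm (f s))%:E).

Lemma l1_summableP (f : S -> R[i]) :
  reflect (exists M, forall A : {fset S}, \sum_(s <- A) rnorm (f s) <= M)
    (f \in l1_summable).
Proof.
have absE : (fun s => `|(rnorm (f s))%:E|)%E = (fun s => (rnorm (f s))%:E).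
  by apply/funext => s; rewrite gee0_abs// lee_fin rnorm_ge0.
apply: (iffP (asboolP _)) => [|[M fM]]; rewrite /summable absE.
  move=> oo; exists (l1norm f) => A; rewrite -lee_fin fineK.
    by apply: fsum_le_esum => i; exact: rnorm_ge0.
  by rewrite ge0_fin_numE// esum_ge0// => i _; rewrite lee_fin rnorm_ge0.
exact: le_lt_trans (esum_le_fsum fM) (ltry _).
Qed.

Lemma l1norm_ge (f : S -> R[i]) (A : {fset S}) : f \in l1_summable ->
  \sum_(s <- A) rnorm (f s) <= l1norm f.
Proof.
move=> /l1_summableP[M fM]; rewrite -lee_fin fineK.
  by apply: fsum_le_esum => i; exact: rnorm_ge0.
by apply: esum_fin fM => i; exact: rnorm_ge0.
Qed.

Lemma l1norm_le (f : S -> R[i]) (M : R) :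
  (forall A : {fset S}, \sum_(s <- A) rnorm (f s) <= M) -> l1norm f <= M.
Proof.
move=> fM; rewrite -lee_fin fineK; first exact: esum_le_fsum.
by apply: esum_fin fM => i; exact: rnorm_ge0.
Qed.

Lemma l1_summable_submod : GRing.submod_closed l1_summable.
Proof.
split=> [|k f g /l1_summableP[M fM] /l1_summableP[N gN]]; apply/l1_summableP.
  by exists 0 => A; rewrite big1// => s _; exact: rnorm0.
exists (rnorm k * M + N) => A.
have : \sum_(s <- A) rnorm ((k *: f + g) s) <=
    \sum_(s <- A) (rnorm k * rnorm (f s) + rnorm (g s)).
  by apply: ler_sum => s _; rewrite (le_trans (rnormD _ _))// -rnormZ.
move/le_trans; apply; rewrite big_split/= -mulr_sumr lerD//.
by rewrite ler_wpM2l ?rnorm_ge0.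
Qed.

HB.instance Definition _ :=
  GRing.isSubmodClosed.Build _ _ l1_summable l1_summable_submod.
End ell1.

Record ell1 (R : realType) (S : choiceType) :=
  Ell1 { ell1_fun :> S -> R[i] ; _ : ell1_fun \in l1_summable }.

Section ell1_normed.
Context {R : realType} {S : choiceType}.
Implicit Types a b : ell1 R S.

HB.instance Definition _ := [isSub for @ell1_fun R S].
HB.instance Definition _ := gen_eqMixin (ell1 R S).
HB.instance Definition _ := gen_choiceMixin (ell1 R S).
HB.instance Definition _ := [SubChoice_isSubLmodule of ell1 R S by <:].

Lemma ell1P a b : a =1 b -> a = b.
Proof. by move=> /funext ab; apply: val_inj. Qed.

Lemma ell1_0E s : (0 : ell1 R S) s = 0. Proof. by []. Qed.
Lemma ell1_DE a b s : (a + b) s = a s + b s. Proof. by []. Qed.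
Lemma ell1_ZE (k : R[i]) a s : (k *: a) s = k * a s. Proof. by []. Qed.
Lemma ell1_NE a s : (- a) s = - a s. Proof. by []. Qed.

Let cnorm a : R[i] := (l1norm a)%:C.

Lemma l1norm_ub a (A : {fset S}) : \sum_(s <- A) rnorm (a s) <= l1norm a.
Proof. by apply: l1norm_ge; exact: (valP a). Qed.

Let l1norm_ge0 a : 0 <= l1norm a.
Proof. by have := l1norm_ub a fset0; rewrite big_seq_fset0. Qed.

Let cnormD a b : cnorm (a + b) <= cnorm a + cnorm b.
Proof.
rewrite -rmorphD lecR; apply: l1norm_le => A.
have : \sum_(s <- A) rnorm ((a + b) s) <=
    \sum_(s <- A) (rnorm (a s) + rnorm (b s)).
  by apply: ler_sum => s _; exact: rnormD.
by move/le_trans; apply; rewrite big_split/= lerD// l1norm_ub.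
Qed.

Let l1normZ_le (k : R[i]) a : l1norm (k *: a) <= rnorm k * l1norm a.
Proof.
apply: l1norm_le => A.
rewrite (eq_bigr (fun s => rnorm k * rnorm (a s))) => [|s _]; last exact: rnormZ.
by rewrite -mulr_sumr ler_wpM2l ?rnorm_ge0 ?l1norm_ub.
Qed.

Let cnormZ (k : R[i]) a : cnorm (k *: a) = `|k| * cnorm a.
Proof.
rewrite (rnormE k) -rmorphM; congr (_%:C); apply: le_anti.
rewrite l1normZ_le andTb; have [->|k0] := eqVneq k 0.
  by rewrite rnorm0 mul0r; exact: l1norm_ge0.
rewrite -[a in leLHS](scalerK k0); set b := k *: a.
have := ler_wpM2l (rnorm_ge0 k) (l1normZ_le k^-1 b).
by move=> /le_trans; apply; rewrite mulrA -rnormMr mulfV// rnorm1 mul1r.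
Qed.

Let l1norm_coef a s : rnorm (a s) <= l1norm a.
Proof. by have := l1norm_ub a [fset s]%fset; rewrite big_seq_fset1. Qed.

Let cnorm0_eq0 a : cnorm a = 0 -> a = 0.
Proof.
move=> /complexI a0; apply: ell1P => s; apply: rnorm_eq0.
by apply: le_anti; rewrite rnorm_ge0 andbT -a0 l1norm_coef.
Qed.

HB.instance Definition _ := isPointed.Build (ell1 R S) 0.
HB.instance Definition _ :=
  Lmodule_isNormed.Build R[i] (ell1 R S) cnormD cnormZ cnorm0_eq0.

Lemma ell1_normE a : rnorm a = l1norm a.
Proof. by []. Qed.

Lemma rnorm_coef a s : rnorm (a s) <= rnorm a.
Proof. exact: l1norm_coef. Qed.

Lemma ell1_complete (F : set_system (ell1 R S)) :
  ProperFilter F -> cauchy F -> cvg F.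
Proof.
move=> FF /cauchy_rnormP H.
have coefB (a b : ell1 R S) s : rnorm (a s - b s) <= rnorm (a - b).
  exact: (rnorm_coef (a - b) s).
have pt s : cvg ((a : ell1 R S) s @[a --> F]).
  apply: complex_complete; apply/cauchy_rnormP => e /H[x Fx].
  exists (x s).
  apply: (filterS _ Fx : F [set a | rnorm (x s - (a : ell1 R S) s) < e]).
  by move=> a; apply: le_lt_trans.
pose g s : R[i] := lim ((a : ell1 R S) s @[a --> F]).
have gP s : (a : ell1 R S) s @[a --> F] --> g s by exact: pt.
have close e x : 0 < e -> F [set y | rnorm (x - y) < e] ->
    forall A : {fset S}, \sum_(s <- A) rnorm (x s - g s) <= e.
  move=> e0 Fx A; apply/ler_addgt0Pr => d d0.
  have n0 : 0 < (#|` A|.+1)%:R :> R by rewrite ltr0n.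
  pose d' : R := d / (#|` A|.+1)%:R.
  have d'0 : 0 < d' by rewrite divr_gt0.
  have nearA : \forall a \near F, forall s, s \in A ->
      rnorm (g s - (a : ell1 R S) s) <= d'.
    suff : F (\bigcap_(s in [set` A])
        [set a : ell1 R S | rnorm (g s - a s) <= d']).
      by apply: filterS => a aA s sA; exact: aA.
    apply: filter_bigI => s _.
    by have /cvg_rnorm_leP := gP s; apply.
  near F => a.
  have xa : rnorm (x - a) < e by near: a.
  have ag s : s \in A -> rnorm (g s - a s) <= d'.
    by move: s; near: a.
  have : \sum_(s <- A) rnorm (x s - g s) <=
      \sum_(s <- A) (rnorm (x s - a s) + d').
    rewrite !big_seq; apply: ler_sum => s sA.
    rewrite -(subrKA (a s)) (le_trans (rnormD _ _))// lerD// -rnormN opprB.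
    exact: ag.
  move/le_trans; apply; rewrite big_split/= lerD//.
    exact: le_trans (l1norm_ub (x - a) A) (ltW xa).
  rewrite big_const_seq count_predT iter_addr_0 -[leLHS]mulr_natr /d' -mulrA.
  rewrite ler_piMr ?(ltW d0)// mulrC ler_pdivrMr// mul1r ler_nat.
  exact: leqnSn.
have [x Fx] := H 1 ltr01.
have gS : g \in l1_summable.
  have xg : (x : S -> R[i]) - g \in l1_summable.
    by apply/l1_summableP; exists 1 => A; exact: close Fx A.
  by rewrite -(subKr (x : S -> R[i]) g) rpredB//; exact: (valP x).
apply/cvg_ex; exists (Ell1 gS); apply/cvg_rnorm_leP => e e0.
have e20 : 0 < e / 2 by rewrite divr_gt0.
have [y Fy] := H _ e20; apply: filterS (Fy) => a ya.
rewrite -(subrKA y) (le_trans (rnormD _ _))// (splitr e) lerD ?(ltW ya)//.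
rewrite -rnormN opprB; apply: l1norm_le => A; exact: close Fy A.
Unshelve. all: by end_near. Qed.

HB.instance Definition _ := Uniform_isComplete.Build (ell1 R S) ell1_complete.
End ell1_normed.

#[local] Existing Instance summability.totally_filter.

Section unordered_sums.
Context {R : realType} {I : choiceType}.
Variable E : completeNormedModType R[i].
Implicit Types (x y : I -> E) (A B : {fset I}).

Definition abs_summable x :=
  exists M : R, forall A, \sum_(i <- A) rnorm (x i) <= M.

Lemma big_fset_split (V : nmodType) (F : I -> V) A B : (A `<=` B)%fset ->
  \sum_(i <- B) F i = \sum_(i <- A) F i + \sum_(i <- B | i \notin A) F i.
Proof.
move=> /fsubsetP AB; rewrite (bigID (mem A))/=; congr (_ + _).
rewrite big_fset_condE; apply: congr_big => //.
suff -> : [fset i in B | mem A i]%fset = A by [].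
by apply/fsetP => i; rewrite !inE/= andb_idl// => /AB.
Qed.

Lemma partial_sumE x A : summability.partial_sum x A = \sum_(i <- A) x i.
Proof. by rewrite /summability.partial_sum big_seq_fsetE. Qed.

Lemma abs_summable_tail (F : I -> R) (M e : R) : (forall i, 0 <= F i) ->
    (forall A, \sum_(i <- A) F i <= M) -> 0 < e ->
  exists A, forall B, \sum_(i <- B | i \notin A) F i <= e.
Proof.
move=> F0 FM e0; pose X := [set \sum_(i <- A) F i | A in [set: {fset I}]].
have hX : has_sup X.
  split; first by exists (\sum_(i <- fset0) F i); exists fset0.
  by exists M => _ [A _ <-].
have [_ [A _ <-] XA] := sup_adherent e0 hX.
exists A => B; rewrite -(lerD2l (\sum_(i <- A) F i)).
apply: le_trans (_ : sup X <= _); last by rewrite -lerBlDr ltW.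
have : \sum_(i <- (A `|` B)%fset) F i <= sup X.
  by apply: ub_le_sup; [case: hX|exists (A `|` B)%fset].
apply: le_trans; rewrite le_eqVlt; apply/orP; left; apply/eqP; symmetry.
rewrite (big_fsetID _ (mem A))/=.
have -> : [fset i in (A `|` B)%fset | i \in A]%fset = A.
  by apply/fsetP => i; rewrite !inE/=; case: (i \in A) => //; rewrite ?andbT ?andbF.
have -> : [fset i in (A `|` B)%fset | i \notin A]%fset =
    [fset i in B | i \notin A]%fset.
  by apply/fsetP => i; rewrite !inE/=; case: (i \in A); case: (i \in B).
by rewrite -big_fset_condE.
Qed.

Lemma sum_cvg x : abs_summable x ->
  \sum_(i <- A) x i @[A --> summability.totally] --> summability.sum x.
Proof.
move=> [M xM].
rewrite -(eq_cvg _ _ (partial_sumE x)).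
apply: cauchy_cvg; apply/cauchy_rnormP => e e0.
have e20 : 0 < e / 2 by rewrite divr_gt0.
have [A Ae] := abs_summable_tail (fun i => rnorm_ge0 (x i)) xM e20.
exists (summability.partial_sum x A); exists A => // B /= AB.
rewrite !partial_sumE.
rewrite (big_fset_split _ AB).
rewrite opprD addNKr rnormN (le_lt_trans (rnorm_sum _ _ _))//.
by rewrite (le_lt_trans (Ae B))// [ltRHS]splitr ltrDl.
Qed.

Lemma sumE x (l : E) :
  \sum_(i <- A) x i @[A --> summability.totally] --> l -> summability.sum x = l.
Proof.
by rewrite -(eq_cvg _ _ (partial_sumE x)) => xl; apply/cvg_lim.
Qed.

Lemma sum_linear (k : R[i]) x y : abs_summable x -> abs_summable y ->
  summability.sum (fun i => k *: x i + y i) =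
  k *: summability.sum x + summability.sum y.
Proof.
move=> /sum_cvg xl /sum_cvg yl; apply: sumE.
under eq_fun do rewrite big_split/= -scaler_sumr.
by apply: cvgD => //; apply: cvgZr.
Qed.

Lemma rnorm_sum_le x (M : R) : (forall A, \sum_(i <- A) rnorm (x i) <= M) ->
  rnorm (summability.sum x) <= M.
Proof.
move=> xM; have /sum_cvg/cvg_rnorm_leP xl : abs_summable x by exists M.
apply/ler_addgt0Pr => e /xl [A _ /(_ A) /=]; rewrite fsubset_refl => /(_ isT) xA.
rewrite -(subrK (\sum_(i <- A) x i) (summability.sum x)).
rewrite (le_trans (rnormD _ _))// addrC lerD//.
exact: le_trans (rnorm_sum _ _ _) (xM A).
Qed.

End unordered_sums.

Section ell1_basis.
Context {R : realType} {S : choiceType}.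

Let delta_sum (A : {fset S}) s :
  \sum_(t <- A) rnorm ((t == s)%:R : R[i]) <= 1.
Proof.
have [sA|sA] := boolP (s \in A).
  rewrite (big_fsetD1 s)//= eqxx rnorm1 big1_seq ?addr0// => t.
  by rewrite !inE => /andP[_ /andP[/negbTE -> _]]; exact: rnorm0.
rewrite big1_seq// => t /andP[_ tA].
by case: eqP => [ts|_]; [move: sA; rewrite -ts tA|exact: rnorm0].
Qed.

Lemma delta_subproof (s : S) :
  (fun t => (t == s)%:R : R[i]) \in @l1_summable R S.
Proof. by apply/l1_summableP; exists 1 => A; exact: delta_sum. Qed.

Definition delta (s : S) : ell1 R S := Ell1 (delta_subproof s).

Lemma deltaE s t : delta s t = (t == s)%:R.
Proof. by []. Qed.

Lemma rnorm_delta_le s : rnorm (delta s) <= 1.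
Proof. by apply: l1norm_le => A; exact: delta_sum. Qed.

Lemma ell1_sumE (A : {fset S}) (a : S -> ell1 R S) t :
  (\sum_(s <- A) a s) t = \sum_(s <- A) a s t.
Proof. by elim/big_ind2 : _ => // _ x _ y <- <-. Qed.

Lemma ell1_approx (a : ell1 R S) (e : R) : 0 < e ->
  exists A : {fset S}, rnorm (a - \sum_(s <- A) a s *: delta s) <= e.
Proof.
move=> e0.
have [A Ae] := abs_summable_tail (fun s => rnorm_ge0 (a s)) (l1norm_ub a) e0.
exists A; apply: l1norm_le => B; apply: le_trans (Ae B).
rewrite [leRHS]big_mkcond/= le_eqVlt; apply/orP; left; apply/eqP.
apply: eq_bigr => t _.
transitivity (rnorm (a t - (\sum_(s <- A) a s *: delta s) t)); first by [].
rewrite ell1_sumE (eq_bigr (fun s => a s * (t == s)%:R)) => [|s _]; last by [].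
have [tA|tA]/= := boolP (t \in A).
  rewrite (big_fsetD1 t)//= eqxx mulr1 big1_seq ?addr0.
    by rewrite subrr rnorm0.
  move=> s /andP[_]; rewrite !inE => /andP[st _].
  by rewrite eq_sym (negbTE st) mulr0.
rewrite big1_seq ?subr0// => s /andP[_ sA].
rewrite (_ : t == s = false) ?mulr0//.
by apply: contraNF tA => /eqP ->.
Qed.

Lemma ell1_ext (V : normedModType R[i]) (f g : blin (ell1 R S) V) :
  (forall s, f (delta s) = g (delta s)) -> f = g.
Proof.
move=> fg; apply/eqP; rewrite -subr_eq0; apply/eqP.
set h := f - g.
have hd s : h (delta s) = 0.
  by transitivity (f (delta s) - g (delta s)); rewrite // fg subrr.
apply: blinP => a; apply: rnorm_eq0; apply: le_anti; rewrite rnorm_ge0 andbT.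
apply/ler_addgt0Pr => e e0; rewrite add0r.
have n0 : 0 < rnorm h + 1 by rewrite ltr_wpDl ?rnorm_ge0.
have [A Ae] := ell1_approx a (divr_gt0 e0 n0).
have -> : h a = h (a - \sum_(s <- A) a s *: delta s).
  rewrite linearB linear_sum big1_seq ?subr0// => s _.
  by transitivity (a s *: h (delta s)); [exact: linearZ|rewrite hd scaler0].
apply: le_trans (blin_le _ _) _; apply: le_trans (ler_wpM2l (rnorm_ge0 h) Ae) _.
by rewrite mulrCA ler_piMr ?(ltW e0)// ler_pdivrMr// mul1r lerDl.
Qed.

Lemma abs_summable_lift (E : completeNormedModType R[i]) (M : R) (v : S -> E)
    (a : ell1 R S) : 0 <= M -> (forall s, rnorm (v s) <= M) ->
  forall A : {fset S}, \sum_(s <- A) rnorm (a s *: v s) <= M * rnorm a.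
Proof.
move=> M0 vM A; apply: le_trans (_ : \sum_(s <- A) M * rnorm (a s) <= _).
  apply: ler_sum => s _; rewrite rnormZ mulrC.
  by apply: ler_wpM2r; [exact: rnorm_ge0|exact: vM].
by rewrite -mulr_sumr ler_wpM2l// l1norm_ub.
Qed.

(* \sum_s a s *: v s, an unordered norm-convergent sum when v is bounded: the
   bounded linear map ell1 -> E with delta s |-> v s (lemma l1_sum_delta) *)
Definition l1_sum (E : completeNormedModType R[i]) (v : S -> E) (a : ell1 R S) : E :=
  summability.sum (fun s => a s *: v s).

Lemma rnorm_l1_sum (E : completeNormedModType R[i]) (M : R) (v : S -> E)
    (a : ell1 R S) : 0 <= M -> (forall s, rnorm (v s) <= M) ->
  rnorm (l1_sum v a) <= M * rnorm a.
Proof. by move=> M0 vM; apply: rnorm_sum_le; exact: abs_summable_lift. Qed.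

Lemma l1_sum_linear (E : completeNormedModType R[i]) (M : R) (v : S -> E) :
  0 <= M -> (forall s, rnorm (v s) <= M) -> linear (l1_sum v).
Proof.
move=> M0 vM k a b; rewrite /l1_sum -sum_linear.
- congr summability.sum; apply/funext => s.
  by rewrite ell1_DE ell1_ZE scalerDl scalerA.
- by exists (M * rnorm a) => A; exact: abs_summable_lift.
- by exists (M * rnorm b) => A; exact: abs_summable_lift.
Qed.

Lemma l1_sum_linear_l (E : completeNormedModType R[i]) (M N : R) (v w : S -> E)
    (k : R[i]) (a : ell1 R S) :
  0 <= M -> 0 <= N -> (forall s, rnorm (v s) <= M) -> (forall s, rnorm (w s) <= N) ->
  l1_sum (fun s => k *: v s + w s) a = k *: l1_sum v a + l1_sum w a.
Proof.
move=> M0 N0 vM wN; rewrite /l1_sum -sum_linear.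
- congr summability.sum; apply/funext => s.
  by rewrite scalerDr !scalerA mulrC.
- by exists (M * rnorm a) => A; exact: abs_summable_lift.
- by exists (N * rnorm a) => A; exact: abs_summable_lift.
Qed.

Lemma l1_sum_delta (E : completeNormedModType R[i]) (v : S -> E) s :
  l1_sum v (delta s) = v s.
Proof.
apply: sumE; apply: cvg_near_cst; exists [fset s]%fset => // A /= sA.
rewrite (big_fsetD1 s) ?(fsubsetP sA) ?inE//= eqxx scale1r.
rewrite big1_seq ?addr0// => t /andP[_]; rewrite !inE => /andP[/negbTE -> _].
by rewrite scale0r.
Qed.

End ell1_basis.

Section biflat.
Context {R : realType}.

(* universal property of the projective tensor product of Banach spaces; the
   bounds make T unique up to isometric isomorphism *)
Record is_projective_tensor (A B T : completeNormedModType R[i])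
    (tens : {bilinear A -> B -> T}) : Prop := {
  projective_norm : forall a b, rnorm (tens a b) <= rnorm a * rnorm b ;
  projective_lift : forall (E : completeNormedModType R[i])
      (f : {bilinear A -> B -> E}) (M : R), 0 <= M ->
      (forall a b, rnorm (f a b) <= M * (rnorm a * rnorm b)) ->
    exists2 L : blin T E, forall a b, L (tens a b) = f a b & rnorm L <= M ;
  projective_uniq : forall (E : completeNormedModType R[i]) (L L' : blin T E),
    (forall a b, L (tens a b) = L' (tens a b)) -> L = L'
}.

(* pi, lact and ract exist and are unique by the universal property of T.
   In the bidual, (a . Phi)(phi) = Phi(phi . a) with (phi . a)(u) = phi(a . u),
   so a acts by the second adjoint of u |-> a . u, and likewise on the right. *)
Definition biflat (A : banachAlgType R[i]) (C : R) : Prop :=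
  exists (T : completeNormedModType R[i]) (tens : {bilinear A -> A -> T}),
  is_projective_tensor tens /\
  exists (pi : blin T A) (lact ract : A -> blin T T),
  [/\ forall a b, pi (tens a b) = a ** b,
      forall a b c, lact a (tens b c) = tens (a ** b) c,
      forall a b c, ract a (tens b c) = tens b (c ** a) &
  exists sigma : blin A (dual (dual T)),
  [/\ forall a b, sigma (a ** b) = adjoint (adjoint (lact a)) (sigma b),
      forall a b, sigma (a ** b) = adjoint (adjoint (ract b)) (sigma a),
      forall a, adjoint (adjoint pi) (sigma a) = bidual_emb A a &
      rnorm sigma <= C]].

End biflat.

Section ell1_tensor.
Context {R : realType} {S S' : choiceType}.

Let slice (s : S) (b : ell1 R S') : ell1 R (S * S')%type :=
  l1_sum (fun t => delta (s, t)) b.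

Definition ell1_tensor (a : ell1 R S) (b : ell1 R S') : ell1 R (S * S')%type :=
  l1_sum (fun s => l1_sum (fun t => delta (s, t)) b) a.

Let delta_le (s : S) t : rnorm (@delta R _ (s, t : S')) <= 1.
Proof. exact: rnorm_delta_le. Qed.

Let slice_le b s : rnorm (slice s b) <= rnorm b.
Proof. by rewrite -[leRHS]mul1r; exact: rnorm_l1_sum (ler01) (delta_le s). Qed.

Let tens_l b : linear (ell1_tensor ^~ b).
Proof. exact: l1_sum_linear (rnorm_ge0 b) (slice_le b). Qed.

Let tens_r a : linear (ell1_tensor a).
Proof.
move=> k b c; rewrite /ell1_tensor.
rewrite -(l1_sum_linear_l k a (rnorm_ge0 b) (rnorm_ge0 c) (slice_le b) (slice_le c)).
congr l1_sum; apply/funext => s.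
exact: l1_sum_linear ler01 (delta_le s) k b c.
Qed.

HB.instance Definition _ :=
  bilinear_isBilinear.Build R[i] (ell1 R S) (ell1 R S') (ell1 R (S * S')%type)
    *:%R *:%R ell1_tensor (conj tens_l tens_r).

Lemma tens_delta s t :
  ell1_tensor (delta s) (delta t) = delta (s, t).
Proof. by rewrite /ell1_tensor !l1_sum_delta. Qed.

Lemma ell1_tensor_norm a b : rnorm (ell1_tensor a b) <= rnorm a * rnorm b.
Proof. by rewrite mulrC; exact: rnorm_l1_sum (rnorm_ge0 b) (slice_le b). Qed.

Lemma ell1_projective :
  is_projective_tensor
    (ell1_tensor : {bilinear ell1 R S -> ell1 R S' -> ell1 R (S * S')%type}).
Proof.
split; first exact: ell1_tensor_norm.
  move=> E f M M0 fM.
  have vM (p : S * S') : rnorm (f (delta p.1) (delta p.2)) <= M.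
    apply: le_trans (fM _ _) _; rewrite ler_piMr// mulr_ile1 ?rnorm_ge0//.
      exact: rnorm_delta_le.
    exact: rnorm_delta_le.
  have bl : l1_sum (fun p : S * S' => f (delta p.1) (delta p.2)) \in bounded_linear.
    apply/bounded_linearP; split; first exact: l1_sum_linear M0 vM.
    by exists M => a; exact: rnorm_l1_sum.
  exists (Blin bl); last by apply: opnorm_le => // a; exact: rnorm_l1_sum.
  have tE s t : ell1_tensor (delta s) (delta t) = delta (s, t) :> ell1 R _.
    exact: tens_delta.
  have tl b : ell1_tensor ^~ b \in bounded_linear.
    apply/bounded_linearP; split; first exact: tens_l.
    by exists (rnorm b) => a; rewrite mulrC; exact: ell1_tensor_norm.
  have tr a : ell1_tensor a \in bounded_linear.
    apply/bounded_linearP; split; first exact: tens_r.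
    by exists (rnorm a) => b; exact: ell1_tensor_norm.
  have fl b : f ^~ b \in bounded_linear.
    apply/bounded_linearP; split; first by move=> k x y; rewrite linearPl.
    by exists (M * rnorm b) => a; rewrite -mulrA (mulrC (rnorm b)); exact: fM.
  have fr a : f a \in bounded_linear.
    apply/bounded_linearP; split; first by move=> k x y; rewrite linearPr.
    by exists (M * rnorm a) => b; rewrite -mulrA; exact: fM.
  move=> a b.
  suff H1 s : l1_sum (fun p : S * S' => f (delta p.1) (delta p.2))
      (ell1_tensor (delta s) b) = f (delta s) b.
    suff : blin_comp (Blin bl) (Blin (tl b)) = Blin (fl b).
      by move=> /(congr1 (fun g : blin _ _ => g a)).
    by apply: ell1_ext => s; exact: H1.
  suff H2 t : l1_sum (fun p : S * S' => f (delta p.1) (delta p.2))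
      (ell1_tensor (delta s) (delta t)) = f (delta s) (delta t).
    suff : blin_comp (Blin bl) (Blin (tr (delta s))) = Blin (fr (delta s)).
      by move=> /(congr1 (fun g : blin _ _ => g b)).
    by apply: ell1_ext => t; exact: H2.
  by rewrite tE l1_sum_delta.
move=> E L L' LL'; apply: ell1_ext => -[s t].
by rewrite -tens_delta; exact: LL'.
Qed.
End ell1_tensor.

Section pointwise_product.
Context {R : realType} {S : choiceType}.
Implicit Types a b : ell1 R S.

Lemma pmul_subproof a b : (fun s => a s * b s) \in @l1_summable R S.
Proof.
apply/l1_summableP; exists (rnorm a * rnorm b) => A.
apply: le_trans (_ : \sum_(s <- A) rnorm a * rnorm (b s) <= _).
  apply: ler_sum => s _; rewrite rnormMr.
  by apply: ler_wpM2r; [exact: rnorm_ge0|exact: rnorm_coef].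
by rewrite -mulr_sumr; apply: ler_wpM2l; [exact: rnorm_ge0|exact: l1norm_ub].
Qed.

Definition pmul a b : ell1 R S := Ell1 (pmul_subproof a b).

Lemma pmul_norm a b : rnorm (pmul a b) <= rnorm a * rnorm b.
Proof.
apply: l1norm_le => A.
apply: le_trans (_ : \sum_(s <- A) rnorm a * rnorm (b s) <= _).
  apply: ler_sum => s _; rewrite rnormMr.
  by apply: ler_wpM2r; [exact: rnorm_ge0|exact: rnorm_coef].
by rewrite -mulr_sumr; apply: ler_wpM2l; [exact: rnorm_ge0|exact: l1norm_ub].
Qed.

End pointwise_product.

Section semilattice_algebra.
Context {R : realType} {d : Order.disp_t} {S : meetSemilatticeType d}.
Implicit Types a b c : ell1 R S.

Let trans (s : S) b : ell1 R S := l1_sum (fun t => delta (s `&` t)%O) b.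

(* \sum_(s, t) a s * b t *: delta (s `&` t) *)
Definition conv a b : ell1 R S :=
  l1_sum (fun s => l1_sum (fun t => delta (s `&` t)%O) b) a.

Lemma conv_delta s t : conv (delta s) (delta t) = delta (s `&` t)%O.
Proof. by rewrite /conv !l1_sum_delta. Qed.

Let delta_le (s : S) t : rnorm (@delta R S (s `&` t)%O) <= 1.
Proof. exact: rnorm_delta_le. Qed.

Let trans_le b s : rnorm (trans s b) <= rnorm b.
Proof. by rewrite -[leRHS]mul1r; exact: rnorm_l1_sum (ler01) (delta_le s). Qed.

Lemma conv_norm a b : rnorm (conv a b) <= rnorm a * rnorm b.
Proof.
by rewrite mulrC; exact: rnorm_l1_sum (rnorm_ge0 b) (trans_le b).
Qed.

Lemma conv_linear_l b : linear (conv ^~ b).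
Proof. exact: l1_sum_linear (rnorm_ge0 b) (trans_le b). Qed.

Lemma conv_linear_r a : linear (conv a).
Proof.
move=> k b c; rewrite /conv.
rewrite -(l1_sum_linear_l k a (rnorm_ge0 b) (rnorm_ge0 c) (trans_le b) (trans_le c)).
congr l1_sum; apply/funext => s.
exact: l1_sum_linear ler01 (delta_le s) k b c.
Qed.

Let convl_subproof a : conv a \in bounded_linear.
Proof.
apply/bounded_linearP; split; first exact: conv_linear_r.
by exists (rnorm a) => b; exact: conv_norm.
Qed.

Let convr_subproof b : conv ^~ b \in bounded_linear.
Proof.
apply/bounded_linearP; split; first exact: conv_linear_l.
by exists (rnorm b) => a; rewrite mulrC; exact: conv_norm.
Qed.

Let convl a := Blin (convl_subproof a).
Let convr a := Blin (convr_subproof a).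

Lemma convA : associative conv.
Proof.
move=> a b c.
suff H1 s : conv (delta s) (conv b c) = conv (conv (delta s) b) c.
  suff : convr (conv b c) = blin_comp (convr c) (convr b).
    by move=> /(congr1 (fun f : blin _ _ => f a)).
  by apply: ell1_ext => s; exact: H1.
suff H2 t : conv (delta s) (conv (delta t) c) = conv (conv (delta s) (delta t)) c.
  suff : blin_comp (convl (delta s)) (convr c) =
         blin_comp (convr c) (convl (delta s)).
    by move=> /(congr1 (fun f : blin _ _ => f b)).
  by apply: ell1_ext => t; exact: H2.
suff H3 u : conv (delta s) (conv (delta t) (delta u)) =
    conv (conv (delta s) (delta t)) (delta u).
  suff : blin_comp (convl (delta s)) (convl (delta t)) =
         convl (conv (delta s) (delta t)).
    by move=> /(congr1 (fun f : blin _ _ => f c)).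
  by apply: ell1_ext => u; exact: H3.
by rewrite !conv_delta meetA.
Qed.

Lemma convDl a b c : conv (a + b) c = conv a c + conv b c.
Proof. exact: (linearD (convr c)). Qed.

Lemma convDr a b c : conv a (b + c) = conv a b + conv a c.
Proof. exact: (linearD (convl a)). Qed.

Lemma convZl (k : R[i]) a b : k *: conv a b = conv (k *: a) b.
Proof. by have := linearZZ (convr b) k a => /esym. Qed.

Lemma convZr (k : R[i]) a b : k *: conv a b = conv a (k *: b).
Proof. by have := linearZZ (convl a) k b => /esym. Qed.

(* the values of the Schutzenberger representation are bounded functions, see
   Sch_norm *)
Definition Sch a : S -> R[i] :=
  fun y => l1_sum (fun t => (y <= t)%O%:R : R[i]) a.

Lemma Sch_delta t y : Sch (delta t) y = (y <= t)%O%:R.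
Proof. exact: l1_sum_delta. Qed.

Lemma Sch_norm a y : rnorm (Sch a y) <= rnorm a.
Proof.
rewrite -[leRHS]mul1r; apply: rnorm_l1_sum => // t.
by case: (y <= t)%O; rewrite ?rnorm1 ?rnorm0.
Qed.

End semilattice_algebra.

(* the same Banach space ell1 R S with the two products conv and pmul; the order
   of S is s <= t iff s `&` t = s (lemma leEmeet) *)
Definition semilattice_algebra (R : realType) d (S : meetSemilatticeType d) :=
  ell1 R S.
Definition pointwise_algebra (R : realType) (S : choiceType) := ell1 R S.

Section algebra_instances.
Context (R : realType) (d : Order.disp_t) (S : meetSemilatticeType d).

HB.instance Definition _ :=
  CompleteNormedModule.copy (semilattice_algebra R S) (ell1 R S).

Let conv_le (a b : semilattice_algebra R S) :
  `|conv a b : semilattice_algebra R S| <= `|a| * `|b|.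
Proof. by rewrite !rnormE -rmorphM lecR; exact: conv_norm. Qed.

HB.instance Definition _ := isBanachAlgebra.Build R[i] (semilattice_algebra R S)
  convA convDl convDr convZl convZr conv_le.

End algebra_instances.

Section pointwise_instance.
Context (R : realType) (S : choiceType).
Implicit Types a b c : ell1 R S.

HB.instance Definition _ :=
  CompleteNormedModule.copy (pointwise_algebra R S) (ell1 R S).

Let pmulA : associative (@pmul R S).
Proof. by move=> a b c; apply: ell1P => s; exact: mulrA. Qed.
Let pmulDl a b c : pmul (a + b) c = pmul a c + pmul b c.
Proof. by apply: ell1P => s; exact: mulrDl. Qed.
Let pmulDr a b c : pmul a (b + c) = pmul a b + pmul a c.
Proof. by apply: ell1P => s; exact: mulrDr. Qed.
Let pmulZl (k : R[i]) a b : k *: pmul a b = pmul (k *: a) b.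
Proof. by apply: ell1P => s; exact: mulrA. Qed.
Let pmulZr (k : R[i]) a b : k *: pmul a b = pmul a (k *: b).
Proof. by apply: ell1P => s; exact: mulrCA. Qed.
Let pmul_le (a b : pointwise_algebra R S) :
  `|pmul a b : pointwise_algebra R S| <= `|a| * `|b|.
Proof. by rewrite !rnormE -rmorphM lecR; exact: pmul_norm. Qed.

HB.instance Definition _ := isBanachAlgebra.Build R[i] (pointwise_algebra R S)
  pmulA pmulDl pmulDr pmulZl pmulZr pmul_le.
End pointwise_instance.

Definition locally_finite d (S : meetSemilatticeType d) (R : realType) (C : R) : Prop :=
  forall f : S, finite_set [set y | (y <= f)%O] /\
    (#|` fset_set [set y | (y <= f)%O]|%:R <= C).

(* Main.v *)
Require Import Defs.
From HB Require Import structures.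
From mathcomp Require Import all_boot all_order all_algebra finmap sesquilinear.
From mathcomp Require Import all_classical all_reals all_analysis.
From mathcomp Require Import complex.
Import numFieldNormedType.Exports.
Import Order.TTheory GRing.Theory Num.Theory.
Set Implicit Arguments.
Unset Strict Implicit.
Local Open Scope classical_set_scope.
Local Open Scope ring_scope.

(* For t in S let chi_t(a) = Sch(a)(t), a character of norm at most 1, and let
   coef_t(a) = a_t.  Since coef_t and chi_t agree on the ideal e_t A, the module
   property and pi'' sigma = kappa give sigma(e_f)(coef_t (x) chi_t) = 1 for
   t <= f.  For a finite set D below f, the functional
   \sum_(t in D) coef_t (x) chi_t on the projective tensor product has norm at
   most 1, so #|D| <= C.
   Once S is locally finite, m(s, x) = sigma(e_x)(coef_s (x) chi_x) is the
   Moebius function of S: rho_x = \sum_(s <= x) m(s, x) e_s satisfies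
   Sch(rho_x) = delta_x, and testing sigma(e_x) against
   (\sum_s u_s coef_s) (x) chi_x with |u_s| <= 1 shows that rho_x has norm at
   most C. *)

(** * Bounded maps and functionals on a projective tensor product *)

Section projective_tensor.
Context {R : realType} {A B T : completeNormedModType R[i]}.
Context {tens : {bilinear A -> B -> T}}.
Hypothesis Ttens : is_projective_tensor tens.

(** [projective_lift] for a bare function: the bilinear structure is packed on the spot from the two
    linearity hypotheses. *)
Lemma exists_projective_lift (E : completeNormedModType R[i]) (f : A -> B -> E)
    (M : R) : (forall b, linear (f ^~ b)) -> (forall a, linear (f a)) ->
  0 <= M -> (forall a b, rnorm (f a b) <= M * (rnorm a * rnorm b)) ->
  exists2 L : blin T E, forall a b, L (tens a b) = f a b & rnorm L <= M.
Proof.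
move=> fl fr.
pose fB := bilinear_isBilinear.Build R[i] A B E *:%R *:%R f (conj fl fr).
pose F : {bilinear A -> B -> E} := HB.pack_for {bilinear A -> B -> E} f fB.
exact: (projective_lift Ttens (f := F)).
Qed.

(** The lift of [L \o tens] has norm at most [M] and, by uniqueness, is [L]. Operator norms can thus
    be tested on elementary tensors. *)
Lemma projective_rnorm (E : completeNormedModType R[i]) (L : blin T E) (M : R) :
  0 <= M -> (forall a b, rnorm (L (tens a b)) <= M * (rnorm a * rnorm b)) ->
  rnorm L <= M.
Proof.
move=> M0 LM.
have fl b : linear (fun a => L (tens a b)).
  by move=> k x y; rewrite linearPl linearP.
have fr a : linear (fun b => L (tens a b)).
  by move=> k x y; rewrite linearPr linearP.
have [L' L'E L'M] := exists_projective_lift fl fr M0 LM.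
by rewrite -(projective_uniq Ttens L'E).
Qed.

Lemma exists_tensor_form (phi : dual A) (psi : dual B) :
  exists L : dual T, forall a b, L (tens a b) = phi a * psi b.
Proof.
have [|||a b|L LE _] :=
  @exists_projective_lift _ (fun a b => phi a * psi b : R[i])
    (rnorm phi * rnorm psi).
- by move=> b k x y; rewrite linearP mulrDl -mulrA.
- by move=> a k x y; rewrite linearP mulrDr mulrCA.
- by rewrite mulr_ge0 ?rnorm_ge0.
- by rewrite rnormMr mulrACA ler_pM ?rnorm_ge0 ?blin_le.
- by exists L.
Qed.

End projective_tensor.

(** Packages [l1_sum v] as a bounded operator; both [Sch] and its inverse are built this way. *)
Lemma exists_l1_lift (R : realType) (I : choiceType)
    (E : completeNormedModType R[i]) (v : I -> E) (M : R) :
  0 <= M -> (forall s, rnorm (v s) <= M) ->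
  exists2 L : blin (ell1 R I) E, forall s, L (delta s) = v s & rnorm L <= M.
Proof.
move=> M0 vM.
have bl : l1_sum v \in bounded_linear.
  apply/bounded_linearP; split; first exact: l1_sum_linear M0 vM.
  by exists M => a; exact: rnorm_l1_sum.
exists (Blin bl) => [s|]; first exact: l1_sum_delta.
by apply: opnorm_le => // a; exact: rnorm_l1_sum.
Qed.

(** * Coefficients, characters and multiplication operators *)

Section semilattice_functionals.
Context {R : realType} {d : Order.disp_t} {S : meetSemilatticeType d}.
Local Notation A := (semilattice_algebra R S).
Local Notation e s := (delta s : A).

Lemma coef_subproof (s : S) : (fun a : ell1 R S => a s) \in bounded_linear.
Proof.
by apply/bounded_linearP; split=> //; exists 1 => a; rewrite mul1r rnorm_coef.
Qed.

Definition coef (s : S) : dual A := Blin (coef_subproof s).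

Lemma Sch_subproof (g : S) : (fun a : ell1 R S => Sch a g) \in bounded_linear.
Proof.
apply/bounded_linearP; split; last by exists 1 => a; rewrite mul1r Sch_norm.
apply: (l1_sum_linear (ler01 : 0 <= 1 :> R)) => t.
by case: (g <= t)%O; rewrite ?rnorm1 ?rnorm0.
Qed.

Definition chi (g : S) : dual A := Blin (Sch_subproof g).

Lemma lmul_subproof (a : A) : (fun b : A => a ** b) \in bounded_linear.
Proof.
apply/bounded_linearP; split; first exact: conv_linear_r.
by exists (rnorm a) => b; exact: conv_norm.
Qed.

Definition lmul (a : A) : blin A A := Blin (lmul_subproof a).

Lemma rmul_subproof (b : A) : (fun a : A => a ** b) \in bounded_linear.
Proof.
apply/bounded_linearP; split; first exact: conv_linear_l.
by exists (rnorm b) => a; rewrite mulrC; exact: conv_norm.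
Qed.

Definition rmul (b : A) : blin A A := Blin (rmul_subproof b).

Lemma bmul_delta s t : e s ** e t = e (s `&` t)%O.
Proof. exact: conv_delta. Qed.

Lemma coef_delta s t : coef s (e t) = (s == t)%:R.
Proof. by []. Qed.

Lemma chi_delta g t : chi g (e t) = (g <= t)%O%:R.
Proof. exact: Sch_delta. Qed.

Lemma blin_ext (V : normedModType R[i]) (f g : blin A V) :
  (forall s, f (e s) = g (e s)) -> f =1 g.
Proof. by move=> fg a; rewrite (ell1_ext fg). Qed.

(** On [e s] this says that g lies below the meet of t and s iff it lies below both; density of the
    span of the basis does the rest. *)
Lemma chi_lmul g t a : chi g (e t ** a) = (g <= t)%O%:R * chi g a.
Proof.
apply: (@blin_ext _ (blin_comp (chi g) (lmul (e t))) ((g <= t)%O%:R *: chi g)).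
move=> s; change (chi g (e t ** e s) = (g <= t)%O%:R * chi g (e s)).
by rewrite bmul_delta !chi_delta lexI -mulnb natrM.
Qed.

Lemma chiM g a b : chi g (a ** b) = chi g a * chi g b.
Proof.
rewrite mulrC.
apply: (@blin_ext _ (blin_comp (chi g) (rmul b)) (chi g b *: chi g)).
move=> s; change (chi g (e s ** b) = chi g b * chi g (e s)).
by rewrite chi_delta chi_lmul mulrC.
Qed.

Lemma chi_rmul g t a : chi g (a ** e t) = chi g a * (g <= t)%O%:R.
Proof. by rewrite chiM chi_delta. Qed.

(** On [e s] both sides test whether the meet of t and s is t, that is, t <= s. *)
Lemma coef_lmul t a : coef t (e t ** a) = chi t a.
Proof.
apply: (@blin_ext _ (blin_comp (coef t) (lmul (e t))) (chi t)) => s.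
change (coef t (e t ** e s) = chi t (e s)).
by rewrite bmul_delta coef_delta chi_delta leEmeet eq_sym.
Qed.

(** Elements of the ideal e_x A are supported on the finite set [D], so there chi_g is a finite
    combination of coefficients. On [e r] only the term at the meet of x and r survives. *)
Lemma chi_lmul_coef (D : {fset S}) g x a : (forall s, (s \in D) = (s <= x)%O) ->
  chi g (e x ** a) = \sum_(s <- D) (g <= s)%O%:R * coef s (e x ** a).
Proof.
move=> Dx; pose f : dual A := \sum_(s <- D) (g <= s)%O%:R *: coef s.
have fE b : f b = \sum_(s <- D) (g <= s)%O%:R * coef s b.
  by rewrite /f; elim/big_ind2 : _ => // _ u _ v <- <-.
rewrite -fE.
apply: (@blin_ext _ (blin_comp (chi g) (lmul (e x)))
                    (blin_comp f (lmul (e x)))).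
move=> r; change (chi g (e x ** e r) = f (e x ** e r)).
rewrite bmul_delta chi_delta fE.
under eq_bigr do rewrite coef_delta.
rewrite (big_fsetD1 (x `&` r)%O) ?Dx ?leIl//= eqxx mulr1.
rewrite big1_seq ?addr0// => s /andP[_].
by rewrite !inE => /andP[/negbTE -> _]; rewrite mulr0.
Qed.

End semilattice_functionals.

(** * Values of sigma on elementary functionals *)

Section diagonal.
Context {R : realType} {d : Order.disp_t} {S : meetSemilatticeType d}.
Local Notation A := (semilattice_algebra R S).
Local Notation e s := (delta s : A).
Context {T : completeNormedModType R[i]} {tens : {bilinear A -> A -> T}}.
Hypothesis Ttens : is_projective_tensor tens.
Context {p : blin T A} {lact ract : A -> blin T T}.
Hypothesis piE : forall a b, p (tens a b) = a ** b.
Hypothesis lactE : forall a b c, lact a (tens b c) = tens (a ** b) c.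
Hypothesis ractE : forall a b c, ract a (tens b c) = tens b (c ** a).
Context {sigma : blin A (dual (dual T))}.
Hypothesis sigmaL : forall a b,
  sigma (a ** b) = adjoint (adjoint (lact a)) (sigma b).
Hypothesis sigmaR : forall a b,
  sigma (a ** b) = adjoint (adjoint (ract b)) (sigma a).
Hypothesis sigma_pi : forall a,
  adjoint (adjoint p) (sigma a) = bidual_emb A a.

(** The functional phi (x) psi, picked from an existence statement; [tensor_form_uniq] makes the
    choice harmless. *)
Definition tensor_form (phi psi : dual A) : dual T :=
  projT1 (cid (exists_tensor_form Ttens phi psi)).

Lemma tensor_formE (phi psi : dual A) a b :
  tensor_form phi psi (tens a b) = phi a * psi b.
Proof. exact: (projT2 (cid (exists_tensor_form Ttens phi psi)) a b). Qed.

Lemma tensor_form_uniq (phi psi : dual A) (L : dual T) :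
  (forall a b, L (tens a b) = phi a * psi b) -> tensor_form phi psi = L.
Proof.
move=> LE; apply: (projective_uniq Ttens) => a b.
by rewrite LE tensor_formE.
Qed.

Implicit Types phi psi theta : dual A.

Definition diag x (phi psi : dual A) : R[i] :=
  sigma (e x) (tensor_form phi psi).

(** sigma(e_x e_y) = e_x . sigma(e_y), and the second adjoint moves the action of e_x onto the left
    factor of the functional. The meet is a separate equation so that z can be any known form of
    it. *)
Lemma diag_lmul x y z (phi phi' psi : dual A) : (x `&` y)%O = z ->
  (forall a, phi (e x ** a) = phi' a) -> diag z phi psi = diag y phi' psi.
Proof.
move=> <- phiE; rewrite /diag -bmul_delta sigmaL.
rewrite (@tensor_form_uniq phi' psi
  (blin_comp (tensor_form phi psi) (lact (e x)))) // => a b.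
change (tensor_form phi psi (lact (e x) (tens a b)) = phi' a * psi b).
by rewrite lactE tensor_formE phiE.
Qed.

Lemma diag_rmul x y z (phi psi psi' : dual A) : (x `&` y)%O = z ->
  (forall b, psi (b ** e y) = psi' b) -> diag z phi psi = diag x phi psi'.
Proof.
move=> <- psiE; rewrite /diag -bmul_delta sigmaR.
rewrite (@tensor_form_uniq phi psi'
  (blin_comp (tensor_form phi psi) (ract (e y)))) // => a b.
change (tensor_form phi psi (ract (e y) (tens a b)) = phi a * psi' b).
by rewrite ractE tensor_formE psiE.
Qed.

(** The hypothesis says that phi (x) psi is theta o pi, so pi'' sigma = kappa gives the value. *)
Lemma diag_pi x (phi psi theta : dual A) :
  (forall a b, phi a * psi b = theta (a ** b)) ->
  diag x phi psi = theta (e x).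
Proof.
move=> thetaE; transitivity (bidual_emb A (e x) theta); last by [].
rewrite -sigma_pi /diag.
rewrite (@tensor_form_uniq _ _ (blin_comp theta p)) // => a b.
by change (theta (p (tens a b)) = phi a * psi b); rewrite piE thetaE.
Qed.

Definition sum_form (D : {fset S}) (c : S -> R[i]) (phi psi : S -> dual A) :
    dual T :=
  \sum_(s <- D) c s *: tensor_form (phi s) (psi s).

Lemma sum_formE (D : {fset S}) c (phi psi : S -> dual A) a b :
  sum_form D c phi psi (tens a b) = \sum_(s <- D) c s * (phi s a * psi s b).
Proof.
transitivity (\sum_(s <- D) c s * tensor_form (phi s) (psi s) (tens a b)).
  by rewrite /sum_form; elim/big_ind2 : _ => // _ u _ v <- <-.
by under eq_bigr do rewrite tensor_formE.
Qed.

Lemma sigma_sum_form (D : {fset S}) c (phi psi : S -> dual A) x :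
  sigma (e x) (sum_form D c phi psi) =
  \sum_(s <- D) c s * diag x (phi s) (psi s).
Proof.
rewrite /sum_form linear_sum; apply: eq_bigr => s _.
transitivity (c s *: (diag x (phi s) (psi s) : R[i])); last by [].
exact: linearZ.
Qed.

Lemma diag_suml (D : {fset S}) c (phi : S -> dual A) (phi' psi : dual A) x :
  (forall a, phi' a = \sum_(s <- D) c s * phi s a) ->
  diag x phi' psi = \sum_(s <- D) c s * diag x (phi s) psi.
Proof.
move=> phiE; rewrite -(sigma_sum_form D c phi (fun=> psi)) /diag.
rewrite (@tensor_form_uniq phi' psi (sum_form D c phi (fun=> psi))) // => a b.
by rewrite sum_formE phiE mulr_suml; under eq_bigr do rewrite mulrA.
Qed.

(** By the bound on elementary tensors, [sum_form] has norm at most 1, as does [e x]. Both the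
    cardinality bound and the Moebius bound rest on this. *)
Lemma rnorm_sum_diag (D : {fset S}) c (phi psi : S -> dual A) x :
  (forall a b, rnorm (\sum_(s <- D) c s * (phi s a * psi s b)) <=
               rnorm a * rnorm b) ->
  rnorm (\sum_(s <- D) c s * diag x (phi s) (psi s)) <= rnorm sigma.
Proof.
move=> D1; rewrite -sigma_sum_form.
have L1 : rnorm (sum_form D c phi psi) <= 1.
  apply: (projective_rnorm Ttens) => // a b; rewrite sum_formE mul1r; exact: D1.
apply: le_trans (blin_le _ _) _.
apply: le_trans (ler_wpM2l (rnorm_ge0 _) L1) _; rewrite mulr1.
apply: le_trans (blin_le _ _) _.
by rewrite ler_piMr ?rnorm_ge0 ?rnorm_delta_le.
Qed.

(** If g is not below x, chi_g vanishes on e_x A. If g = x, multiplicativity of chi_x allows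
    [diag_pi]. If g < x, passing from e_x to e_g = e_x e_g keeps the value, and chi_x vanishes on A
    e_g. *)
Lemma diag_chi g x : diag x (chi g) (chi x) = (g == x)%:R.
Proof.
have diag0l y psi : diag y (0 : dual A) psi = 0.
  rewrite (@diag_suml fset0 0 (fun=> 0) _ psi y) ?big_seq_fset0// => a.
  by rewrite big_seq_fset0.
have [gx|gx] := boolP (g <= x)%O; last first.
  have /negbTE -> : g != x by apply: contraNneq gx => ->.
  rewrite (diag_lmul _ (meetxx x) (phi' := 0 : dual A))// => a.
  by rewrite chi_lmul (negbTE gx) mul0r.
have [->|gNx] := eqVneq g x.
  by rewrite (@diag_pi _ _ _ (chi x)) ?chi_delta ?lexx// => a b; rewrite chiM.
transitivity (diag g (chi g) (chi x)).
  symmetry; apply: (diag_lmul _ (meet_idPl gx)) => a.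
  by rewrite chi_lmul lexx mul1r.
rewrite (diag_rmul _ (meet_idPr gx) (psi' := 0 : dual A)); last first.
  move=> b; rewrite chi_rmul (_ : (x <= g)%O = false) ?mulr0//.
  by apply: contraNF gNx => xg; apply/eqP/le_anti; rewrite gx.
rewrite /diag (@tensor_form_uniq (chi g) 0 0) ?linear0// => a b.
by rewrite [RHS]mulr0.
Qed.

(** Right absorption of e_t replaces f by t; left absorption then turns coef_t into chi_t. *)
Lemma diag_coef_chi t f : (t <= f)%O -> diag f (coef t) (chi t) = 1.
Proof.
move=> tf; transitivity (diag t (coef t) (chi t)).
  symmetry; apply: (diag_rmul _ (meet_idPr tf)) => a.
  by rewrite chi_rmul lexx mulr1.
transitivity (diag t (chi t) (chi t)); last by rewrite diag_chi eqxx.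
by apply: (diag_lmul _ (meetxx t)) => a; rewrite coef_lmul.
Qed.

Lemma card_le_rnorm (D : {fset S}) f : (forall s, s \in D -> (s <= f)%O) ->
  #|` D|%:R <= rnorm sigma.
Proof.
move=> Df.
have <- : rnorm (\sum_(s <- D) 1 * diag f (coef s) (chi s)) = #|` D|%:R.
  rewrite big_seq (eq_bigr (fun=> 1)) => [|s sD]; last first.
    by rewrite mul1r diag_coef_chi ?Df.
  rewrite -big_seq big_const_seq count_predT iter_addr_0.
  rewrite -[1 *+ _]/(_%:R) -(rmorph_nat (real_complex R)).
  by rewrite rnorm_real normr_nat.
apply: rnorm_sum_diag => a b; apply: le_trans (rnorm_sum _ _ _) _.
(* Each |chi_s(b)| is at most the norm of b, and the moduli of the coefficients of a sum to at most
   its norm. *)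
apply: le_trans (_ : \sum_(s <- D) rnorm (coef s a) * rnorm b <= _).
  apply: ler_sum => s _; rewrite mul1r rnormMr.
  by rewrite ler_wpM2l ?rnorm_ge0//; exact: Sch_norm.
by rewrite -mulr_suml ler_wpM2r ?rnorm_ge0//; exact: (l1norm_ub a D).
Qed.

(** * The Moebius function read off from sigma *)

Definition mobius s x := diag x (coef s) (chi x).

Lemma mobiusxx x : mobius x x = 1.
Proof. exact: diag_coef_chi. Qed.

Lemma sum_mobius (D : {fset S}) g x : (forall s, (s \in D) = (s <= x)%O) ->
  \sum_(s <- D) (g <= s)%O%:R * mobius s x = (g == x)%:R.
Proof.
(* [shift phi] is a |-> phi(e_x a). The shift leaves the value at sigma(e_x) unchanged, and only
   after it is chi_g a finite combination of coefficients. *)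
move=> Dx; pose shift phi : dual A := blin_comp phi (lmul (e x)).
have shiftE phi : diag x phi (chi x) = diag x (shift phi) (chi x).
  exact: (diag_lmul _ (meetxx x)).
rewrite -diag_chi shiftE.
rewrite (@diag_suml D (fun s => (g <= s)%O%:R) (fun s => shift (coef s))).
  by apply: eq_bigr => s _; rewrite -shiftE.
by move=> a; exact: chi_lmul_coef.
Qed.

Lemma sum_rnorm_mobius (D : {fset S}) x :
  \sum_(s <- D) rnorm (mobius s x) <= rnorm sigma.
Proof.
(* [u z] is the phase that rotates z to its modulus, with value 0 at z = 0. *)
have /choice[u uE] (z : R[i]) :
    exists u : R[i], rnorm u <= 1 /\ u * z = (rnorm z)%:C%C.
  have [->|z0] := eqVneq z 0; first by exists 0; rewrite rnorm0 mul0r.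
  exists ((rnorm z)%:C%C / z); rewrite divfK//; split=> //.
  have z0' : rnorm z != 0 by apply: contra_neq z0; exact: rnorm_eq0.
  rewrite -(@ler_pM2r _ (rnorm z)) ?lt_def ?z0' ?rnorm_ge0// -rnormMr divfK//.
  by rewrite mul1r rnorm_real ger0_norm ?rnorm_ge0.
have <- : rnorm (\sum_(s <- D) u (mobius s x) * diag x (coef s) (chi x)) =
    \sum_(s <- D) rnorm (mobius s x).
  rewrite (eq_bigr (fun s => (rnorm (mobius s x))%:C%C)) => [|s _].
    rewrite -rmorph_sum/= rnorm_real ger0_norm// sumr_ge0// => s _.
    exact: rnorm_ge0.
  exact: (uE _).2.
apply: (@rnorm_sum_diag _ _ _ (fun=> chi x)) => a b.
apply: le_trans (rnorm_sum _ _ _) _.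
apply: le_trans (_ : \sum_(s <- D) rnorm (coef s a) * rnorm b <= _).
  apply: ler_sum => s _; rewrite !rnormMr -[leRHS]mul1r.
  rewrite ler_pM ?mulr_ge0 ?rnorm_ge0 ?(uE _).1//.
  by rewrite ler_wpM2l ?rnorm_ge0//; exact: Sch_norm.
by rewrite -mulr_suml ler_wpM2r ?rnorm_ge0//; exact: (l1norm_ub a D).
Qed.

End diagonal.

(** * Inversion of the Schutzenberger map between the two algebras *)

Section Schutzenberger_inverse.
Context {R : realType} {d : Order.disp_t} {S : meetSemilatticeType d}.
Local Notation A := (semilattice_algebra R S).
Local Notation P := (pointwise_algebra R S).
Local Notation e s := (delta s : ell1 R S).
Context {down : S -> {fset S}} {mobius : S -> S -> R[i]} {C : R}.
Hypothesis C0 : 0 <= C.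
Hypothesis downE : forall s x, (s \in down x) = (s <= x)%O.
Hypothesis down_le : forall x, #|` down x|%:R <= C.
Hypothesis mobiusxx : forall x, mobius x x = 1.
Hypothesis sum_mobius : forall g x,
  \sum_(s <- down x) (g <= s)%O%:R * mobius s x = (g == x)%:R.
Hypothesis sum_rnorm_mobius : forall x,
  \sum_(s <- down x) rnorm (mobius s x) <= C.

(** The image of e_x under Sch, as an element of [ell1] because [down x] is finite. *)
Definition down_ind x : ell1 R S := \sum_(y <- down x) e y.

Lemma down_indE x y : down_ind x y = (y <= x)%O%:R.
Proof.
rewrite /down_ind ell1_sumE -downE.
rewrite (eq_bigr (fun s => (y == s)%:R)) => [|s _]; last by [].
have [yx|yx] := boolP (y \in down x).
  rewrite (big_fsetD1 y)//= eqxx big1_seq ?addr0// => s /andP[_].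
  by rewrite !inE eq_sym => /andP[/negbTE ->].
rewrite big1_seq// => s /andP[_ sx].
by case: eqP => // ys; move: yx; rewrite ys sx.
Qed.

Lemma rnorm_down_ind x : rnorm (down_ind x) <= C.
Proof.
apply: le_trans (rnorm_sum _ _ _) _; apply: le_trans (down_le x).
apply: le_trans (_ : \sum_(y <- down x) 1 <= _).
  by apply: ler_sum => y _; exact: rnorm_delta_le.
by rewrite big_const_seq count_predT iter_addr_0.
Qed.

(** The element rho_x, the preimage under Sch of the point mass at x. *)
Definition prim_idem x : ell1 R S := \sum_(s <- down x) mobius s x *: e s.

Lemma rnorm_prim_idem x : rnorm (prim_idem x) <= C.
Proof.
apply: le_trans (rnorm_sum _ _ _) _; apply: le_trans (sum_rnorm_mobius x).
by apply: ler_sum => s _; rewrite rnormZ ler_piMr ?rnorm_ge0 ?rnorm_delta_le.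
Qed.

Lemma blin_prim_idem (V : normedModType R[i]) (f : blin (ell1 R S) V) x :
  f (prim_idem x) = \sum_(s <- down x) mobius s x *: f (e s).
Proof.
by rewrite /prim_idem linear_sum; apply: eq_bigr => s _; exact: linearZ.
Qed.

(** [F] lifts [down_ind] and [G] lifts [prim_idem]. [sum_mobius] gives [F \o G] = id directly; the
    other composite is obtained by induction on the size of [down x]. *)
Lemma exists_Sch_inverse : exists SchP : blin A P,
  [/\ forall a y, SchP a y = Sch a y,
      forall a b, SchP (a ** b) = SchP a ** SchP b &
      exists SchPinv : blin P A,
        [/\ cancel SchP SchPinv, cancel SchPinv SchP & rnorm SchPinv <= C]].
Proof.
have [F FE _] := exists_l1_lift (E := P) C0 rnorm_down_ind.
have [G GE GC] := exists_l1_lift (E := A) C0 rnorm_prim_idem.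
have FS a y : F a y = Sch a y.
  have cl : (fun a : P => (a : ell1 R S) y) \in bounded_linear.
    exact: coef_subproof.
  suff : blin_comp (Blin cl) F = chi y.
    by move=> /(congr1 (fun f : blin _ _ => f a)).
  apply: ell1_ext => s; rewrite chi_delta -down_indE.
  by change (F (e s) y = down_ind s y); rewrite FE.
have idb : @id (ell1 R S) \in bounded_linear.
  by apply/bounded_linearP; split=> //; exists 1 => a; rewrite mul1r.
have FG b : F (G b) = b.
  suff : blin_comp F G = Blin idb by move=> /(congr1 (fun f : blin _ _ => f b)).
  apply: ell1_ext => x; change (F (G (e x)) = e x); rewrite GE.
  apply: ell1P => y; change (F (prim_idem x) y = (y == x)%:R).
  rewrite -sum_mobius blin_prim_idem ell1_sumE; apply: eq_bigr => s _.
  by rewrite ell1_ZE FE down_indE mulrC.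
have GF a : G (F a) = a.
  suff : blin_comp G F = Blin idb by move=> /(congr1 (fun f : blin _ _ => f a)).
  apply: ell1_ext => x; change (G (F (e x)) = e x).
  (* G \o F fixes prim_idem x, whose coefficient at e x is 1, and by induction
     it fixes e s for s < x. *)
  have [n] := ubnP #|` down x|; elim: n x => // n IHn x xn.
  (* [prim_idem x] is in the range of [G], where [FG] applies. *)
  have : blin_comp G F (prim_idem x) = prim_idem x.
    transitivity (G (F (G (e x)))); first by rewrite GE.
    by rewrite FG GE.
  rewrite blin_prim_idem [RHS]/prim_idem.
  rewrite [LHS](big_fsetD1 x) ?downE ?lexx//.
  rewrite [RHS](big_fsetD1 x) ?downE ?lexx// mobiusxx !scale1r.
  set u := \sum_(_ <- _) _; set v := \sum_(_ <- _) _.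
  suff -> : u = v by apply: addIr.
  apply: eq_big_seq => s; rewrite !inE downE => /andP[sNx sx].
  congr (_ *: _); apply: IHn; rewrite -ltnS; apply: leq_trans xn; rewrite ltnS.
  (* For s < x, [down s] is a proper subset of [down x], since it omits x. *)
  apply: fproper_ltn_card; rewrite fproperE; apply/andP; split.
    by apply/fsubsetP => y; rewrite !downE => /le_trans; apply.
  apply: contra sNx => /fsubsetP/(_ x); rewrite !downE lexx => /(_ isT) xs.
  by apply/eqP/le_anti; rewrite sx.
exists F; split=> //.
  move=> a b; apply: ell1P => y.
  by change (F (a ** b) y = F a y * F b y); rewrite !FS; exact: (chiM y).
by exists G; split.
Qed.

End Schutzenberger_inverse.

Theorem theorem5p6 (R : realType) (d : Order.disp_t) (S : meetSemilatticeType d)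
    (C : R) (hC : 1 <= C) (hbiflat : biflat (semilattice_algebra R S) C) :
  locally_finite S C /\
  exists SchP : blin (semilattice_algebra R S) (pointwise_algebra R S),
    [/\ forall a y, SchP a y = Sch a y,
        forall a b, SchP (a ** b) = SchP a ** SchP b &
        exists SchPinv : blin (pointwise_algebra R S) (semilattice_algebra R S),
          [/\ cancel SchP SchPinv, cancel SchPinv SchP & rnorm SchPinv <= C]].
Proof.
have [T [tens [Ttens [p [lact [ract [pE lE rE]]]]]]] := hbiflat.
move=> [sigma [sL sR sp sC]].
have card_le (D : {fset S}) f :
    (forall s, s \in D -> (s <= f)%O) -> #|` D|%:R <= C.
  move=> Df; apply: le_trans sC.
  exact: (card_le_rnorm Ttens pE lE rE sL sR sp Df).
(* [fset_set] is empty on an infinite set, so [down] describes the order only once [fin] is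
   established. *)
pose down (f : S) := fset_set [set y | (y <= f)%O].
have fin (f : S) : finite_set [set y | (y <= f)%O].
  (* An infinite principal ideal would contain a finite set with at least [(Num.truncn C).+1] > C
     elements, against [card_le]. *)
  apply: contrapT => /(infinite_set_fset (Num.truncn C).+1)[D Df Dn].
  have := card_le D f (fun s => @Df s); apply/negP; rewrite -ltNge.
  apply: lt_le_trans (_ : (Num.truncn C).+1%:R <= _); first exact: truncnS_gt.
  by rewrite ler_nat.
have downE s x : (s \in down x) = (s <= x)%O.
  by rewrite in_fset_set//; apply/idP/idP; rewrite inE.
have down_le x : #|` down x|%:R <= C.
  by apply: (card_le _ x) => s; rewrite downE.
split=> [f|]; first by split; [exact: fin|exact: down_le].
apply: (exists_Sch_inverse (le_trans ler01 hC) downE down_le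
  (mobius := mobius Ttens (sigma := sigma))).
- exact: (mobiusxx Ttens pE lE rE sL sR sp).
- by move=> g x; exact: (sum_mobius Ttens pE lE rE sL sR sp).
- by move=> x; apply: le_trans sC; exact: sum_rnorm_mobius.
Qed.
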